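(* Let $G=(V_1,E_1)$ be a connected graph with $|V_1|\ge 2$ and $H=(V_2,E_2)$ an arbitrary graph with $|V_2|\ge 1$ and adjacency matrix $A_H$. If the following three conditions are satisfied: (i) $-2-\psi_{H*}^{-1}(\mathrm{QEC}(G))\notin\mathrm{ev}(A_H)$; (ii) $\min\mathrm{ev}(A_H)\ge -2$; (iii) $\mathrm{QEC}(G)\ge 0$; then \[ \mathrm{QEC}(G\odot H)=\psi_{H*}^{-1}(\mathrm{QEC}(G)). \]
   Context: All graphs are finite, simple and undirected. For a connected graph $G=(V,E)$ with $|V|\ge2$ and distance matrix $D=[d(x,y)]_{x,y\in V}$ (graph distance), $\mathrm{QEC}(G)=\max\{\langle f,Df\rangle\,;\, f\in C(V),\ \langle f,f\rangle=1,\ \langle \mathbf{1},f\rangle=0\}$, where $C(V)$ is the space of real column vectors indexed by $V$ with the canonical inner product and $\mathbf{1}$ is the all-one vector. Corona: for graphs $G=(V_1,E_1)$, $H=(V_2,E_2)$ with $V_1\cap V_2=\emptyset$, $G\odot H$ is obtained from $G$ and $|V_1|$ disjoint copies of $H$ (one for each vertex of $G$) by joining each vertex of $G$ to every vertex of its copy of $H$. Functions associated with $H$: let $A_H$ be the adjacency matrix of $H$, $\mathrm{ev}(A_H)$ the set of its distinct eigenvalues, $E_\alpha$ the orthogonal projection onto the eigenspace of $\alpha$ ($E_\alpha=0$ if $\alpha\notin\mathrm{ev}(A_H)$), and $\mathrm{ev}_{\mathrm{M}}(A_H)=\{\alpha\in\mathrm{ev}(A_H)\,;\,E_\alpha\mathbf{1}\ne0\}$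 the set of main eigenvalues. The function $\omega_H$ is the maximal real analytic extension of $\lambda\mapsto 1+\lambda\langle\mathbf{1},(A_H+2+\lambda)^{-1}\mathbf{1}\rangle$ (scalars stand for multiples of $I$), i.e. \[ \omega_H(\lambda)=1+\|E_{-2}\mathbf{1}\|^2+\sum_{\alpha\in\mathrm{ev}_{\mathrm{M}}(A_H)\setminus\{-2\}}\frac{\lambda}{\alpha+2+\lambda}\|E_\alpha\mathbf{1}\|^2 \] on $\mathbb{R}\setminus\{-\alpha-2\,;\,\alpha\in\mathrm{ev}_{\mathrm{M}}(A_H)\setminus\{-2\}\}$. It has at least one real zero; $\lambda_*$ denotes its largest zero. The function $\psi_H$ is the unique real analytic function on $\mathbb{R}\setminus\{\omega_H=0\}$ with $\psi_H(\lambda)=\lambda/\omega_H(\lambda)$ (so $\psi_H(-\alpha-2)=0$ for $\alpha\in\mathrm{ev}_{\mathrm{M}}(A_H)\setminus\{-2\}$). The restriction $\psi_{H*}=\psi_H\restriction_{(\lambda_*,+\infty)}$ is a strictly increasing bijection onto $\mathbb{R}$, and $\psi_{H*}^{-1}:\mathbb{R}\to(\lambda_*,+\infty)$ is its inverse. *)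

(* Defs.v *)
From HB Require Import structures.
From mathcomp Require Import all_boot all_order all_algebra.
From mathcomp Require Import boolp classical_sets functions fsbigop set_interval.
From mathcomp Require Import reals.

Set Implicit Arguments.
Unset Strict Implicit.
Unset Printing Implicit Defensive.

Import Order.TTheory GRing.Theory Num.Theory.

Local Open Scope classical_set_scope.
Local Open Scope ring_scope.

Record sgraph := SGraph {
  vertex :> finType;
  edge : rel vertex;
  edge_sym : symmetric edge;
  edge_irrefl : irreflexive edge }.

Definition gconnected (G : sgraph) : Prop :=
  forall x y : G, connect (@edge G) x y.

(* The default value #|G| is only reached when x and y are not connected: a
   shortest walk between connected vertices has fewer than #|G| steps. *)
Definition gdist (G : sgraph) (x y : G) : nat :=
  \big[minn/#|G|]_(n < #|G| |
      [exists p : n.-tuple G, path (@edge G) x p && (last x p == y)]) n.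

(* inl x is the vertex x of G, inr (x, u) the vertex u of the copy of H
   attached to x. *)
Definition corona_edge (G H : sgraph) : rel (G + G * H)%type :=
  fun a b =>
    match a, b with
    | inl x, inl y => edge x y
    | inl x, inr (y, _) => x == y
    | inr (x, _), inl y => x == y
    | inr (x, u), inr (y, v) => (x == y) && edge u v
    end.

Lemma corona_edge_sym (G H : sgraph) : symmetric (@corona_edge G H).
Proof.
by case=> [x|[x u]] [y|[y v]] /=; rewrite ?(eq_sym x) // edge_sym.
Qed.

Lemma corona_edge_irrefl (G H : sgraph) : irreflexive (@corona_edge G H).
Proof. by case=> [x|[x u]] /=; rewrite edge_irrefl ?andbF. Qed.

Definition corona (G H : sgraph) : sgraph :=
  SGraph (@corona_edge_sym G H) (@corona_edge_irrefl G H).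

(* Vectors indexed by the vertices are row vectors indexed by 'I_#|G|, through
   the enumeration of G. All the matrices below (D, A_H, the projections) are
   symmetric, so that acting on rows or on columns is the same. *)
Section Spectral.
Variable R : realType.

Definition inner n (f g : 'rV[R]_n) : R := \sum_i f 0 i * g 0 i.

Definition ones n : 'rV[R]_n := const_mx 1.

Definition dist_mx (G : sgraph) : 'M[R]_#|G| :=
  \matrix_(i, j) (gdist (enum_val i) (enum_val j))%:R.

Definition adj_mx (G : sgraph) : 'M[R]_#|G| :=
  \matrix_(i, j) (edge (enum_val i) (enum_val j))%:R.

(* Maximum and minimum of a set of reals, 0 when they do not exist. *)
Definition set_max (S : set R) : R := xget 0 (S `&` ubound S).
Definition set_min (S : set R) : R := xget 0 (S `&` lbound S).

Definition QEC (G : sgraph) : R :=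
  set_max [set inner f (f *m dist_mx G) | f in
    [set f : 'rV[R]_#|G| | inner f f = 1 /\ inner (ones #|G|) f = 0]].

Variable H : sgraph.

Definition ev : set R := [set a | eigenvalue (adj_mx H) a].

(* Orthogonal projection (acting on the right) onto the eigenspace of a:
   kermx U^T is the orthogonal complement of the row space of U. *)
Definition eigenproj (a : R) : 'M[R]_#|H| :=
  proj_mx (eigenspace (adj_mx H) a) (kermx (eigenspace (adj_mx H) a)^T).

Definition proj_ones (a : R) : 'rV[R]_#|H| := ones #|H| *m eigenproj a.

Definition evM : set R := [set a | ev a /\ proj_ones a != 0].

(* The formula below is meaningful on omega_dom only; outside, omega takes a
   spurious value because of the convention x / 0 = 0. *)
Definition omega_dom : set R := ~` [set - a - 2 | a in evM `\ (-2)].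

Definition omega (x : R) : R :=
  1 + inner (proj_ones (-2)) (proj_ones (-2)) +
  \sum_(a \in evM `\ (-2))
     x / (a + 2 + x) * inner (proj_ones a) (proj_ones a).

Definition omega_zeros : set R := [set x | omega_dom x /\ omega x = 0].

Definition lambda_star : R := set_max omega_zeros.

(* The points outside omega_dom are poles of omega, where the analytic
   extension of x / omega x vanishes. The values on omega_zeros are
   irrelevant. *)
Definition psi (x : R) : R := if `[< omega_dom x >] then x / omega x else 0.

Definition psi_star_inv : R -> R :=
  'pinv_(fun=> 0) [set x | lambda_star < x] psi.

End Spectral.

Arguments QEC : clear implicits.
Arguments adj_mx : clear implicits.
Arguments dist_mx : clear implicits.
Arguments ev : clear implicits.
Arguments evM : clear implicits.
Arguments psi_star_inv {R} H _.

(* Main.v *)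
(** Write a vector f on the corona as a part g on V_1 and a part h_x on each
    copy of H, and put F(x) = g(x) + <1, h_x>. When f sums to 0, the distances in the
    corona give <f, D f> = <F, D_G F> - sum_x <h_x, (A_H + 2) h_x>, where D_G is
    the distance matrix of G. Let mu = psi_{H*}^{-1}(QEC(G)) >= 0 and
    B = A_H + 2 + mu, which is positive semidefinite by (ii). By (i) there is z
    with B z = 1, so that omega_H(mu) = 1 + mu <1, z> and
    QEC(G) = mu / omega_H(mu). Since <F, D_G F> <= QEC(G) |F|^2, the upper bound
    reduces to the pointwise inequality
    QEC(G) F(x)^2 <= mu g(x)^2 + <h_x, B h_x>, obtained by expanding
    <k, B k> >= 0 for k = h_x - QEC(G) F(x) z. Equality holds for
    g = F / omega_H(mu) and h_x = QEC(G) F(x) z, with F optimal for G. *)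
Require Import Defs.
From mathcomp Require Import all_boot all_order all_algebra.
From mathcomp Require Import boolp classical_sets functions fsbigop reals.
From mathcomp Require Import topology normedtype derive.
From mathcomp Require Import zify ring lra.

Set Implicit Arguments.
Unset Strict Implicit.
Unset Printing Implicit Defensive.

Import Order.TTheory GRing.Theory Num.Theory.
Import numFieldNormedType.Exports.

(** * Distances in the corona *)

Section Distance.
Variable G : sgraph.
Implicit Types x y z : G.
Local Notation e := (@edge G).

Lemma gdist_le x p : path e x p -> gdist x (last x p) <= size p.
Proof.
move=> xp; have [p_lt|] := ltnP (size p) #|G|.
  rewrite /gdist -minEnat -leEnat.
  apply: (bigmin_le_cond _ (fun n : 'I_#|G| => n : nat) (j := Ordinal p_lt)).
  by apply/existsP; exists (in_tuple p); rewrite xp eqxx.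
(* A walk of at least [#|G|] steps is no shorter than the default value of the minimum, which bounds
   [gdist] from above. *)
apply: leq_trans; rewrite /gdist; elim/big_rec: _ => // i n _ n_le.
exact: leq_trans (geq_minr _ _) n_le.
Qed.

Lemma gdist_path x y : connect e x y ->
  exists p, [/\ path e x p, last x p = y & size p = gdist x y].
Proof.
move=> /connectP[p0 xp0 yE].
have : gdist x y = #|G| \/
    exists p, [/\ path e x p, last x p = y & size p = gdist x y].
  rewrite /gdist.
  elim/big_ind: _ => [|m n Km Kn|i /existsP[p /andP[xp /eqP py]]].
  - by left.
  - by have [_|_] := leqP m n.
  - by right; exists p; rewrite size_tuple.
(* The default value is excluded: a walk without repeated vertices has fewer than [#|G|] steps. *)
case=> // dE; case/shortenP: xp0 yE => p xp p_uniq _ yE.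
have := gdist_le xp; rewrite -yE dE leqNgt.
by have := max_card (mem (x :: p)); rewrite (card_uniqP p_uniq)/= => ->.
Qed.

(** Growing by at most one along each edge, [d x] bounds from below the length of every walk from
    [x]; the given walk attains this bound. *)
Lemma gdist_unique (d : G -> G -> nat) x y :
    (forall z, d z z = 0) ->
    (forall z u v, edge u v -> d z v <= (d z u).+1) ->
    (exists p, [/\ path e x p, last x p = y & size p = d x y]) ->
  gdist x y = d x y.
Proof.
move=> d0 dS [p [xp py pE]]; rewrite -pE; apply/eqP.
rewrite eqn_leq -{1}py gdist_le//=.
have [q [xq qy <-]] :
    exists p, [/\ path e x p, last x p = y & size p = gdist x y].
  by apply: gdist_path; apply/connectP; exists p.
have dq r z : path e z r -> d x (last z r) <= d x z + size r.
  elim: r z => [|u r IHr] z /=; first by rewrite addn0.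
  move=> /andP[zu /IHr /leq_trans]; apply.
  by rewrite addnS -addSn leq_add2r dS.
by have := dq _ _ xq; rewrite qy d0 pE.
Qed.

Lemma gdistxx x : gdist x x = 0.
Proof. by apply/eqP; rewrite -leqn0 (@gdist_le x [::]). Qed.

Lemma gdist_edge x y z :
  gconnected G -> edge y z -> gdist x z <= (gdist x y).+1.
Proof.
move=> hG yz; have [p [xp py <-]] := gdist_path (hG x y).
have := @gdist_le x (rcons p z).
by rewrite rcons_path xp py yz last_rcons size_rcons => /(_ isT).
Qed.

End Distance.

Section CoronaDistance.
Variables G H : sgraph.
Hypothesis hG : gconnected G.

(** Different copies communicate only through the vertices of G that carry them; two vertices of one
    copy have that vertex as a common neighbour, hence the value 2. *)
Definition corona_dist (a b : corona G H) : nat :=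
  match a, b with
  | inl x, inl y => gdist x y
  | inl x, inr (y, _) => (gdist x y).+1
  | inr (x, _), inl y => (gdist x y).+1
  | inr (x, u), inr (y, v) =>
      if x == y then if u == v then 0 else if edge u v then 1 else 2
      else (gdist x y).+2
  end.

Lemma path_inl (x : G) p :
  path (@edge (corona G H)) (inl x) (map inl p) = path (@edge G) x p.
Proof. by rewrite path_map. Qed.

Lemma gdist_corona (a b : corona G H) : gdist a b = corona_dist a b.
Proof.
apply: gdist_unique => [[x|[x u]]|c a' b' ab|].
- exact: gdistxx.
- by rewrite /= !eqxx.
- case: c a' b' ab => [x|[x u]] [y|[y v]] [z|[z w]] //=.
  + exact: gdist_edge.
  + by move=> /eqP->.
  + by move=> /eqP->; lia.
  + by move=> /andP[/eqP->].
  + exact: gdist_edge.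
  + move=> /eqP->; have [->|_ //] := eqVneq x z.
    by case: eqP => // _; case: edge.
  + move=> /eqP->; have [->|_] := eqVneq x z; last by lia.
    by rewrite gdistxx.
  + move=> /andP[/eqP-> vw]; have [_|_ //] := eqVneq x z.
    have [//|uw] := eqVneq u w; case: ifP => // uw'; have [uv|//] := eqVneq u v.
      by rewrite uv vw in uw'.
    by case: ifP.
(* Walks of the right length: a shortest walk of G, extended by one step at each end that lies in a
   copy. Inside one copy, the walk is empty, an edge, or the detour through G. *)
- have inlP (x y : G) : exists p, [/\ path (@edge (corona G H)) (inl x) p,
      last (inl x : corona G H) p = inl y & size p = gdist x y].
    have [p [xp py <-]] := gdist_path (hG x y).
    by exists (map inl p); rewrite path_inl (last_map inl) py size_map.
  case: a b => [x|[x u]] [y|[y v]] /=; have [p [xp py pE]] := inlP x y.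
  + by exists p.
  + exists (rcons p (inr (y, v))).
    by rewrite rcons_path last_rcons size_rcons xp py pE /= eqxx.
  + by exists (inl x :: p); rewrite /= eqxx pE.
  + have [<-|xy] := eqVneq x y; last first.
      exists (inl x :: rcons p (inr (y, v))).
      by rewrite /= rcons_path last_rcons size_rcons xp py pE /= !eqxx.
    have [<-|uv] := eqVneq u v; first by exists [::].
    case: ifP => [uv'|_]; first by exists [:: inr (x, v)]; rewrite /= eqxx uv'.
    by exists [:: inl x; inr (x, v)]; rewrite /= !eqxx.
Qed.

End CoronaDistance.

Local Open Scope classical_set_scope.
Local Open Scope ring_scope.

(** * Symmetric real matrices *)

Section InnerProduct.
Variables (R : realType) (n : nat).
Implicit Types (f g h : 'rV[R]_n) (M : 'M[R]_n).

Lemma inner_mulmxE f g : inner f g = (f *m g^T) 0 0.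
Proof. by rewrite mxE; apply: eq_bigr => i _; rewrite mxE. Qed.

Lemma innerC f g : inner f g = inner g f.
Proof. by apply: eq_bigr => i _; rewrite mulrC. Qed.

Lemma innerDl f g h : inner (f + g) h = inner f h + inner g h.
Proof. by rewrite !inner_mulmxE mulmxDl mxE. Qed.

Lemma innerZl a f g : inner (a *: f) g = a * inner f g.
Proof. by rewrite !inner_mulmxE -scalemxAl mxE. Qed.

Lemma innerDr f g h : inner h (f + g) = inner h f + inner h g.
Proof. by rewrite !(innerC h) innerDl. Qed.

Lemma innerZr a f g : inner g (a *: f) = a * inner g f.
Proof. by rewrite !(innerC g) innerZl. Qed.

Lemma inner_sumr (I : Type) (s : seq I) (P : pred I) (F : I -> 'rV[R]_n) f :
  inner f (\sum_(i <- s | P i) F i) = \sum_(i <- s | P i) inner f (F i).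
Proof.
have inner0 : inner f 0 = 0 by rewrite -(scale0r 0) innerZr mul0r.
by apply: (big_morph (inner f) _ inner0) => g h; rewrite innerDr.
Qed.

Lemma inner_ge0 f : 0 <= inner f f.
Proof. by apply: sumr_ge0 => i _; rewrite -expr2 sqr_ge0. Qed.

Lemma inner_eq0 f : inner f f = 0 -> f = 0.
Proof.
move=> /eqP; rewrite psumr_eq0 => [|i _]; last by rewrite -expr2 sqr_ge0.
move=> /allP f0; apply/rowP => i; rewrite mxE; apply/eqP.
by have := f0 i (mem_index_enum _); rewrite mulf_eq0 orbb.
Qed.

Lemma inner_sym M f g : M^T = M -> inner (f *m M) g = inner f (g *m M).
Proof. by move=> Msym; rewrite !inner_mulmxE trmx_mul Msym mulmxA. Qed.

Lemma sub_orthP m (U : 'M[R]_(m, n)) f :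
  reflect (forall g, (g <= U)%MS -> inner f g = 0) (f <= kermx U^T)%MS.
Proof.
apply: (iffP idP) => [/sub_kermxP fU g /submxP[u ->]|fU].
  by rewrite inner_mulmxE trmx_mul mulmxA fU mul0mx mxE.
apply/sub_kermxP/rowP => i; rewrite [RHS]mxE -(fU _ (row_sub i U)) mxE.
by apply: eq_bigr => j _; rewrite !mxE.
Qed.

End InnerProduct.

(** * Maximization of quadratic forms on a subspace *)

Section Rayleigh.
Variable R : realType.

Lemma inner_continuous n (T : topologicalType) (F G : T -> 'rV[R]_n) :
    (forall i, continuous (fun x => F x 0 i)) ->
    (forall i, continuous (fun x => G x 0 i)) ->
  continuous (fun x => inner (F x) (G x)).
Proof.
move=> cF cG x; rewrite /continuous_at /inner.
apply: (@cvg_big _ _ _ _ _ (@add_continuous R)) => i _.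
by apply: cvgM; [exact: cF|exact: cG].
Qed.

Lemma mulmxr_continuous n m (M : 'M[R]_(n, m)) i :
  continuous (fun f : 'rV[R]_n => (f *m M) 0 i).
Proof.
rewrite (_ : (fun f : 'rV[R]_n => _) = fun f => \sum_j f 0 j * M j i).
  apply: (continuous_big (@add_continuous R)) => j _ f.
  apply: (@continuousM _ _ (fun f : 'rV[R]_n => f 0 j)).
    exact: coord_continuous.
  exact: cst_continuous.
by apply/funext => f; rewrite mxE.
Qed.

(** The unit sphere of the row space of [W] is compact, so the form attains its maximum there;
    homogeneity extends the bound to all of [W]. *)
Lemma rayleigh n m (M : 'M[R]_n) (W : 'M[R]_(m, n)) : W != 0 ->
  exists f, [/\ (f <= W)%MS, inner f f = 1 &
    forall g, (g <= W)%MS -> inner g (g *m M) <= inner f (f *m M) * inner g g].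
Proof.
move=> /rowV0Pn[g0 g0W g0_neq0].
pose A := ([set f : 'rV[R]_n | inner f f = 1] `&`
  [set f : 'rV[R]_n | (f <= W)%MS]).
have normalize g : (g <= W)%MS -> g != 0 ->
    exists2 c, c ^+ 2 * inner g g = 1 & A (c *: g).
  move=> gW g_neq0; have gg : 0 < inner g g.
    rewrite lt_def inner_ge0 andbT; apply: contra_neq g_neq0; exact: inner_eq0.
  have cE : (Num.sqrt (inner g g))^-1 ^+ 2 * inner g g = 1.
    by rewrite exprVn sqr_sqrtr ?inner_ge0// mulVf// gt_eqF.
  exists (Num.sqrt (inner g g))^-1 => //; split => /=; last exact: scalemx_sub.
  by rewrite innerZl innerZr mulrA -expr2.
have [c0 _ Ac0] := normalize _ g0W g0_neq0.
have compA : compact A.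
  apply: bounded_closed_compact.
    exists 1; split; first exact: num_real.
    move=> x x1 f [/= f1 _]; apply/(le_trans _ (ltW x1)).
    rewrite [leLHS]/Num.norm /= mx_normrE; apply/bigmax_leP.
    split=> // -[i j] _ /=.
    rewrite -(@ler_pXn2r _ 2) ?nnegrE// expr1n -f1 real_normK ?num_real//.
    rewrite /inner (bigD1 j)//= ord1 -expr2 lerDl.
    by apply: sumr_ge0 => k _; rewrite -expr2 sqr_ge0.
  apply: closedI.
    apply: (@preimage_closed _ _ (fun f : 'rV[R]_n => inner f f) [set 1]).
      by move=> f _; apply: inner_continuous => i; exact: coord_continuous.
    exact: closed_eq.
  (* The row space of [W] is closed as the zero set of a continuous function: [cokermx W]
     annihilates exactly its vectors. *)
  pose residual (f : 'rV[R]_n) := f *m cokermx W.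
  rewrite (_ : mkset _ =
      (fun f => inner (residual f) (residual f)) @^-1` [set 0]).
    apply: preimage_closed => [f _|]; last exact: closed_eq.
    by apply: inner_continuous => i; exact: mulmxr_continuous.
  apply/seteqP; split=> f /=.
    by rewrite submxE /residual => /eqP->; rewrite inner_mulmxE mul0mx mxE.
  by move=> /inner_eq0/eqP; rewrite submxE.
have [||f /set_mem[/= f1 fW] fmax] := @compact_EVT_max _ R
    (fun f : 'rV[R]_n => inner f (f *m M)) A _ compA.
- by exists (c0 *: g0).
- apply: continuous_subspaceT; apply: inner_continuous => i.
    exact: coord_continuous.
  exact: mulmxr_continuous.
exists f; split=> // g gW; have [->|g_neq0] := eqVneq g 0.
  by rewrite mul0mx !inner_mulmxE !mul0mx !mxE mulr0.
have [c c1 Ac] := normalize _ gW g_neq0.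
have := fmax _ (mem_set Ac).
rewrite -scalemxAl innerZl innerZr mulrA -expr2 => le_f.
rewrite -(ler_pM2l (_ : 0 < c ^+ 2)); last first.
  rewrite lt_def sqr_ge0 andbT; apply: contra_eq_neq c1 => ->.
  by rewrite mul0r eq_sym oner_eq0.
by rewrite mulrCA c1 mulr1.
Qed.

(** Stability keeps the residual [f *m M - l *: f] of a maximizer [f] inside [W], and maximality
    along that direction forces the residual to vanish. *)
Lemma rayleigh_eigen n m (M : 'M[R]_n) (W : 'M[R]_(m, n)) :
    M^T = M -> stablemx W M -> W != 0 ->
  exists f l, [/\ (f <= W)%MS, inner f f = 1, f *m M = l *: f &
    forall g, (g <= W)%MS -> inner g (g *m M) <= l * inner g g].
Proof.
move=> Msym WM /(rayleigh M)[f [fW f1 fmax]].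
exists f, (inner f (f *m M)); split=> //; set l := inner f (f *m M).
have [g gE] : exists g, f *m M = g + l *: f.
  by exists (f *m M - l *: f); rewrite subrK.
suff g0 : g = 0 by rewrite gE g0 add0r.
have gW : (g <= W)%MS.
  rewrite -[g](addrK (l *: f)) -gE addmx_sub ?eqmx_opp ?scalemx_sub//.
  exact: submx_trans (submxMr M fW) WM.
(* First variation of the Rayleigh quotient at the maximizer f, in the
   direction of the residual g. *)
apply: inner_eq0; set a := inner g g; set b := l * a - inner g (g *m M).
have b_ge0 : 0 <= b by rewrite subr_ge0 fmax.
have var t : 2 * t * a <= t ^+ 2 * b.
  have := fmax (f + t *: g); rewrite addmx_sub ?scalemx_sub// => /(_ isT).
  have -> : inner (f + t *: g) ((f + t *: g) *m M) =
      l + 2 * t * inner g (f *m M) + t ^+ 2 * inner g (g *m M).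
    rewrite mulmxDl -scalemxAl !(innerDl, innerDr, innerZl, innerZr).
    by rewrite (innerC f (g *m M)) inner_sym// -/l; ring.
  rewrite !(innerDl, innerDr, innerZl, innerZr) f1 (innerC f g) -/a.
  have -> : inner g (f *m M) = a + l * inner g f.
    by rewrite gE innerDr innerZr.
  by rewrite -/l /b; lra.
have a_ge0 : 0 <= a := inner_ge0 g.
apply/eqP; rewrite eq_le a_ge0 andbT.
(* If [a > 0], then [t = a / (b + 1)] violates [var], the difference of the two sides being
   [t ^+ 2 * (b + 2)]. The shift by 1 avoids dividing by [b = 0]. *)
have b1 : 0 < b + 1 by rewrite ltr_wpDl.
have := var (a / (b + 1)); rewrite leNgt => /negP nlt.
rewrite leNgt; apply/negP => a_gt0; apply: nlt.
rewrite -subr_gt0.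
have -> : 2 * (a / (b + 1)) * a - (a / (b + 1)) ^+ 2 * b =
   (a / (b + 1)) ^+ 2 * (b + 2) by field; rewrite gt_eqF.
by rewrite mulr_gt0 ?exprn_gt0 ?divr_gt0// ltr_wpDl.
Qed.

End Rayleigh.

(** * Decomposition along the eigenspaces *)

Section Spectral.
Variables (R : realType) (n : nat) (M : 'M[R]_n).
Hypothesis Msym : M^T = M.

(** Roots are split off one at a time, excluded middle deciding whether one is left; the size of the
    polynomial bounds the recursion. *)
Lemma poly_roots_seq (F : fieldType) (p : {poly F}) : p != 0 ->
  exists2 s : seq F, uniq s & forall x, root p x = (x \in s).
Proof.
move=> p_neq0; have := leqnn (size p); move: {2}(size p) => k.
elim: k => [|k IHk] in p p_neq0 *.
  by rewrite leqn0 size_poly_eq0 (negPf p_neq0).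
have [[x px]|nroot] := pselect (exists x, root p x); last first.
  by exists [::] => // x; apply/negbTE/negP => px; apply: nroot; exists x.
have /factor_theorem[q pE] := px; rewrite pE in p_neq0 *.
have q_neq0 : q != 0 by apply: contra_neq p_neq0 => ->; rewrite mul0r.
rewrite size_Mmonic ?monicXsubC// size_XsubC addn2/= ltnS => /(IHk _ q_neq0).
move=> [s _ sE]; exists (undup (x :: s)) => [|y]; first exact: undup_uniq.
by rewrite mem_undup in_cons rootM root_XsubC sE orbC.
Qed.

Lemma eigenspace_orth a b f g : (f <= eigenspace M a)%MS ->
  (g <= eigenspace M b)%MS -> a != b -> inner f g = 0.
Proof.
move=> /eigenspaceP fa /eigenspaceP gb ab; apply/eqP.
have : (a - b) * inner f g = 0.
  by rewrite mulrBl -innerZl -innerZr -fa -gb inner_sym// subrr.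
by move/eqP; rewrite mulf_eq0 subr_eq0 (negPf ab).
Qed.

(** The orthogonal complement of the sum [U] of the eigenspaces is stable under [M]. If it were
    nonzero, it would contain a unit eigenvector, which lies in [U] too and would be orthogonal to
    itself. *)
Lemma eigenspace_decomposition : exists2 s : seq R,
   uniq s /\ (forall a, eigenvalue M a = (a \in s)) &
  forall f, exists2 v : R -> 'rV[R]_n,
   (forall a, (v a <= eigenspace M a)%MS) & f = \sum_(a <- s) v a.
Proof.
have [|s s_uniq sE] := @poly_roots_seq _ (char_poly M).
  exact/monic_neq0/char_poly_monic.
have evE a : eigenvalue M a = (a \in s) by rewrite eigenvalue_root_char sE.
exists s => // f.
pose U := (\sum_(i < size s) eigenspace M s`_i)%MS.
have subU a (g : 'rV[R]_n) : (g <= eigenspace M a)%MS -> (g <= U)%MS.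
  have [/eqP Ea0|] := boolP (eigenspace M a == 0).
    by rewrite Ea0 submx0 => /eqP->; exact: sub0mx.
  rewrite -/(eigenvalue M a) evE => /(nthP 0)[i i_lt <-] gE.
  exact: (sumsmx_sup (Ordinal i_lt)).
have UM : (U *m M <= U)%MS.
  rewrite sumsmxMr; apply/sumsmx_subP => i _; apply: (sumsmx_sup i) => //.
  by rewrite (eigenspaceP (submx_refl _)) scalemx_sub.
have [/eqP W0|W_neq0] := eqVneq (kermx U^T) 0; last first.
  have WM : stablemx (kermx U^T) M.
    apply/rV_subP => g /submxP[h ->]; rewrite mulmxA; apply/sub_orthP => k kU.
    rewrite inner_sym//; apply/(sub_orthP U _ (submxMl h _)).
    exact: submx_trans (submxMr M kU) UM.
  have [g [l [gW g1 gM _]]] := rayleigh_eigen Msym WM W_neq0.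
  have gU : (g <= U)%MS by apply: (subU l); apply/eigenspaceP.
  by move: gW => /sub_orthP/(_ _ gU)/eqP; rewrite g1 oner_eq0.
have /sub_sumsmxP[u fE] : (f <= U)%MS.
  by apply: submx_full; rewrite /row_full -mxrank_tr -/(row_free _) -kermx_eq0.
(* For [a] outside [s] the index is [size s], so [insub] fails and the component is 0. *)
exists (fun a => oapp (fun i => u i *m eigenspace M a) 0 (insub (index a s))).
  by move=> a; case: insubP => /= [i _ _|_]; [exact: submxMl|exact: sub0mx].
rewrite fE (big_nth 0) big_mkord; apply: eq_bigr => i _.
by rewrite index_uniq// valK.
Qed.

End Spectral.

(** * The function omega *)

Lemma seq_min d (T : orderType d) (s : seq T) : s != [::] ->
  exists2 m, m \in s & forall x, x \in s -> (m <= x)%O.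
Proof.
elim: s => // x [_ _|y s IHs _].
  by exists x; rewrite ?inE// => y /[!inE]/eqP->.
have [m ms m_min] := IHs isT.
have [xm|/ltW mx] := leP x m.
  exists x => [|z]; first by rewrite inE eqxx.
  by rewrite inE => /predU1P[->//|/m_min]; apply: le_trans.
exists m => [|z]; first by rewrite inE ms orbT.
by rewrite inE => /predU1P[->//|/m_min].
Qed.

Section SecularFunction.
Variables (R : realType) (t : seq R) (w : R -> R) (c : R).
Hypothesis t_gt : forall a, a \in t -> 0 < a + 2.
Hypothesis w_gt0 : forall a, a \in t -> 0 < w a.
Hypothesis c_gt0 : 0 < c.

(* This is omega when t lists the main eigenvalues other than -2, w a is the
   squared norm of the projection of the all-one vector, and c = 1 + w (-2). *)
Definition secular x : R := c + \sum_(a <- t) x / (a + 2 + x) * w a.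

Lemma secular0 : secular 0 = c.
Proof. by rewrite /secular big1 ?addr0// => a _; rewrite !mul0r. Qed.

(** To the right of its pole, each fraction is [1 - (a + 2) / (a + 2 + x)], which increases with
    [x]. *)
Lemma secular_lt x y : t != [::] -> (forall a, a \in t -> 0 < a + 2 + x) ->
  x < y -> secular x < secular y.
Proof.
move=> t_neq0 tx xy; rewrite ltrD2l [ltLHS]big_seq [ltRHS]big_seq.
apply: ltr_sum => [|a at_].
  by case: t t_neq0 => // a u _; apply/hasP; exists a; rewrite inE eqxx.
have ax := tx _ at_; have a2 := t_gt at_.
have ay : 0 < a + 2 + y by apply: lt_trans ax _; rewrite ltrD2l.
rewrite ltr_pM2r ?w_gt0// ltr_pdivrMr// mulrAC ltr_pdivlMr// -subr_gt0.
by rewrite (_ : _ - _ = (a + 2) * (y - x)) ?mulr_gt0 ?subr_gt0//; ring.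
Qed.

Lemma secular_continuous x : (forall a, a \in t -> 0 < a + 2 + x) ->
  {for x, continuous secular}.
Proof.
move=> tx; rewrite /continuous_at /secular; apply: cvgD; first exact: cvg_cst.
rewrite big_seq; under eq_fun do rewrite big_seq.
apply: (@cvg_big _ _ _ _ _ (@add_continuous R)) => a at_.
apply: cvgM; last exact: cvg_cst.
apply: cvgM; first exact: cvg_id.
apply: cvgV; last by apply: cvgD; [exact: cvg_cst|exact: cvg_id].
by rewrite gt_eqF// tx.
Qed.

(** This zero lies to the right of every pole, where [secular] increases; it is therefore the
    largest one and will be identified with [lambda_star]. *)
Lemma secular_zero : t != [::] -> exists2 l, l < 0 & secular l = 0 /\
  forall a, a \in t -> 0 < a + 2 + l.
Proof.
move=> t_neq0; have [a0 a0t a0_min] := seq_min t_neq0.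
have p_gt0 := t_gt a0t; have w0_gt0 := w_gt0 a0t.
(* At x1 the term of a0, the one with the pole closest to 0, is equal to
   - c, and the other terms are nonpositive. *)
pose x1 := (a0 + 2) * w a0 / (w a0 + c) - (a0 + 2).
have wc_gt0 : 0 < w a0 + c by rewrite addr_gt0.
have x1p : 0 < a0 + 2 + x1.
  by rewrite /x1 addrC subrK divr_gt0 ?mulr_gt0.
have x1_lt0 : x1 < 0.
  by rewrite /x1 subr_lt0 ltr_pdivrMr// ltr_pM2l// ltrDl.
have tx1 a : a \in t -> 0 < a + 2 + x1.
  by move=> /a0_min a0a; rewrite (lt_le_trans x1p)// !lerD2r.
have om_x1 : secular x1 <= 0.
  rewrite /secular (big_rem a0)//= addrA -[leRHS]addr0 lerD//; last first.
    rewrite big_seq; apply: sumr_le0 => a /mem_rem at_.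
    by rewrite mulr_le0_ge0 ?ltW ?w_gt0// pmulr_llt0// invr_gt0 tx1.
  rewrite le_eqVlt; apply/orP; left; apply/eqP; rewrite /x1; field.
  rewrite (gt_eqF wc_gt0)/= (_ : _ + _ = (a0 + 2) * w a0); last ring.
  by rewrite gt_eqF ?mulr_gt0.
have [|||l /[!in_itv]/=/andP[x1l l0] oml] := @IVT _ secular x1 0 0.
- exact: ltW.
- apply: continuous_in_subspaceT => z /set_mem/=.
  rewrite in_itv => /andP[x1z _].
  apply: secular_continuous => a /tx1 ax1.
  by rewrite (lt_le_trans ax1)// lerD2l.
- by rewrite secular0 ge_min om_x1 le_max (ltW c_gt0) orbT.
exists l; last first.
  by split=> // a /tx1 ax1; rewrite (lt_le_trans ax1)// lerD2l.
rewrite lt_neqAle l0 andbT; apply: contra_eq_neq oml => ->.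
by rewrite secular0 gt_eqF.
Qed.

(** This solves [psi x = q] without division, by the intermediate value theorem on the interval from
    0 to [X]; at [X] the difference is nonnegative because each fraction is at most 1. *)
Lemma secular_solve q : 0 <= q -> exists2 x, 0 <= x & x = q * secular x.
Proof.
move=> q_ge0; pose X := q * (c + \sum_(a <- t) w a).
have w_sum : 0 <= \sum_(a <- t) w a.
  by rewrite big_seq; apply: sumr_ge0 => a /w_gt0/ltW.
have X_ge0 : 0 <= X by rewrite mulr_ge0// addr_ge0 ?(ltW c_gt0).
have [|||x /[!in_itv]/=/andP[x0 xX] xE] :=
  @IVT _ (fun x => x - q * secular x) 0 X 0 => //.
- apply: continuous_in_subspaceT => z /set_mem/=.
  rewrite in_itv => /andP[z_ge0 _].
  rewrite /continuous_at; apply: cvgB; first exact: cvg_id.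
  apply: cvgM; first exact: cvg_cst.
  by apply: secular_continuous => a /t_gt a2; rewrite (lt_le_trans a2)// lerDl.
- rewrite secular0 sub0r ge_min oppr_le0 mulr_ge0 ?(ltW c_gt0)//= le_max.
  apply/orP; right; rewrite subr_ge0 /X ler_wpM2l// lerD2l.
  rewrite big_seq [leRHS]big_seq; apply: ler_sum => a at_.
  have a2 := t_gt at_; rewrite -[leRHS]mul1r ler_wpM2r ?(ltW (w_gt0 at_))//.
  have aX : 0 < a + 2 + X := ltr_pwDl a2 X_ge0.
  by rewrite ler_pdivrMr// mul1r lerDr ltW.
by exists x => //; apply/eqP; rewrite -subr_eq0 xE.
Qed.

End SecularFunction.

Section Extrema.
Variable R : realType.

Lemma set_max_eq (S : set R) m : S m -> ubound S m -> set_max S = m.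
Proof.
move=> Sm ubm; apply: xget_unique => // y [Sy uby].
by apply/eqP; rewrite eq_le ubm// uby.
Qed.

Lemma set_min_eq (S : set R) m : S m -> lbound S m -> set_min S = m.
Proof.
move=> Sm lbm; apply: xget_unique => // y [Sy lby].
by apply/eqP; rewrite eq_le lbm// lby.
Qed.

End Extrema.

(** * The spectrum of H and the value of the inverse of psi *)

Section AdjacencySpectrum.
Variables (R : realType) (H : sgraph).
Hypothesis H_gt0 : (0 < #|H|)%N.
Let A : 'M[R]_#|H| := adj_mx R H.
Let w a : R := inner (proj_ones H a) (proj_ones H a).

Lemma adj_mx_sym : A^T = A.
Proof. by apply/matrixP => i j; rewrite !mxE edge_sym. Qed.

(** Maximizing the form of [- A] over the whole space, nonzero since H has a vertex, produces the
    least eigenvalue; the default value of [set_min] is thus not reached. *)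
Lemma set_min_ev (g : 'rV[R]_#|H|) :
  set_min (ev R H) * inner g g <= inner g (g *m A).
Proof.
have [||f [l [_ f1 fA fmax]]] := @rayleigh_eigen R _ _ (- A) 1%:M _ (submx1 _).
- by rewrite linearN /= adj_mx_sym.
- by rewrite -mxrank_eq0 mxrank1 -lt0n.
have {}fmax h : - l * inner h h <= inner h (h *m A).
  have := fmax h (submx1 _); rewrite mulmxN -scaleN1r innerZr; lra.
have f_neq0 : f != 0.
  apply: contra_eq_neq f1 => ->.
  by rewrite inner_mulmxE mul0mx mxE eq_sym oner_eq0.
rewrite (@set_min_eq _ _ (- l)) //.
  apply/eigenvalueP; exists f => //.
  by rewrite scaleNr -fA mulmxN opprK.
move=> a /eigenvalueP[h hA h_neq0].
have := fmax h; rewrite hA innerZr ler_pM2r// lt_def inner_ge0 andbT.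
by apply: contra_neq h_neq0; exact: inner_eq0.
Qed.

(** The projections are the components of the all-one vector in the eigenspace decomposition:
    [eigenproj H a] fixes the eigenspace of [a] and kills the others, which are orthogonal to it. *)
Lemma spectral_ones : exists2 s : seq R,
    uniq s /\ (forall a, ev R H a <-> a \in s) &
  [/\ ones R #|H| = \sum_(a <- s) proj_ones H a,
      forall a, proj_ones H a *m A = a *: proj_ones H a,
      forall a, a \notin s -> proj_ones H a = 0 &
      forall a, inner (ones R #|H|) (proj_ones H a) = w a].
Proof.
have [s [s_uniq evE] /(_ (ones R #|H|))[v vE onesE]] :=
  eigenspace_decomposition adj_mx_sym.
have v0 a : a \notin s -> v a = 0.
  rewrite -evE negbK => /eqP E0; apply/eqP; rewrite -submx0.
  by rewrite -[in X in (_ <= X)%MS]E0 vE.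
have pE a : proj_ones H a = v a.
  rewrite /proj_ones onesE mulmx_suml.
  have vp b : v b *m eigenproj H a = if b == a then v b else 0.
    have EK0 : (eigenspace A a :&: kermx (eigenspace A a)^T)%MS = 0.
      apply/eqP; rewrite -submx0; apply/rV_subP => f.
      rewrite sub_capmx => /andP[fE /sub_orthP/(_ _ fE)/inner_eq0->].
      exact: sub0mx.
    have [->|ba] := eqVneq b a; first exact: proj_mx_id.
    apply: proj_mx_0 => //; apply/sub_orthP => g gE.
    exact: (eigenspace_orth adj_mx_sym (vE b) gE).
  under eq_bigr do rewrite vp.
  have [as_|/[dup] as_ /v0->] := boolP (a \in s).
    rewrite (bigD1_seq a)//= eqxx big1 ?addr0// => b /negPf->//.
  rewrite big_seq big1// => b bs; case: eqP => // ba.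
  by rewrite -ba bs in as_.
exists s; first by split=> // a; rewrite /ev /= evE.
split=> [|a|a as_|a].
- by rewrite {1}onesE; apply: eq_bigr => a _; rewrite pE.
- by rewrite pE; exact/eigenspaceP.
- by rewrite pE v0.
have [as_|as_] := boolP (a \in s); last first.
  by rewrite /w pE v0// !inner_mulmxE linear0 !mulmx0 mxE.
rewrite innerC {1}onesE inner_sumr (bigD1_seq a)//= /w pE big1 ?addr0// => b ba.
by apply: (eigenspace_orth adj_mx_sym (vE a) (vE b)); rewrite eq_sym.
Qed.

(** This gathers what the corona formula uses about $\omega_H$ and $\psi_H$: [om] is
    $\omega_H(\mu)$, and [z] solves $(A_H+2+\mu)z=\mathbf{1}$. *)
Lemma psi_star_invP q (mu := psi_star_inv H q) :
    -2 <= set_min (ev R H) -> 0 <= q -> ~ ev R H (-2 - mu) ->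
  exists z om, [/\ z *m A + (2 + mu) *: z = ones R #|H|,
    om = 1 + mu * inner (ones R #|H|) z, 0 < om, 0 <= mu & mu = q * om].
Proof.
move=> min_ge q_ge0 mu_nev.
have [s [s_uniq evE] [onesE pA p0 pw]] := spectral_ones.
have ev_ge a : a \in s -> -2 <= a.
  move=> /evE/eigenvalueP[h hA h_neq0].
  have h_gt0 : 0 < inner h h.
    rewrite lt_def inner_ge0 andbT.
    by apply: contra_neq h_neq0; exact: inner_eq0.
  have := set_min_ev h; rewrite hA innerZr ler_pM2r//.
  exact: le_trans.
pose t := [seq a <- s | (a != -2) && (w a != 0)].
have tP a : (a \in t) = [&& a \in s, a != -2 & w a != 0].
  by rewrite mem_filter andbC.
have tE a : a \in t <-> (evM R H `\ (-2)) a.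
  rewrite tP; split=> [/and3P[/evE ea a2 wa]|[[/evE-> pa] a2]].
    split; last exact/eqP.
    split=> //; apply: contra_neq wa => pa.
    by rewrite /w pa inner_mulmxE mul0mx mxE.
  apply/and3P; split=> //; first exact/eqP.
  by apply: contra_neq pa; exact: inner_eq0.
have t_gt a : a \in t -> 0 < a + 2.
  rewrite tP => /and3P[/ev_ge a_ge a2 _].
  by rewrite -[2]opprK subr_gt0 lt_neqAle eq_sym a2.
have w_gt0 a : a \in t -> 0 < w a.
  by rewrite tP => /and3P[_ _ wa]; rewrite lt_def wa inner_ge0.
have t_uniq : uniq t by rewrite filter_uniq.
(* If -2 were the only main eigenvalue, A would map the all-one vector to a
   negative multiple of itself, although its entries are nonnegative. *)
have t_neq0 : t != [::].
  apply/negP => /eqP t0.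
  have : ones R #|H| *m A = -2 *: ones R #|H|.
    rewrite onesE mulmx_suml scaler_sumr big_seq [RHS]big_seq.
    apply: eq_bigr => a as_; rewrite pA.
    have [->//|a2] := eqVneq a (-2).
    have : a \notin t by rewrite t0.
    rewrite tP as_ a2/= negbK => /eqP/inner_eq0->.
    by rewrite !scaler0.
  move=> /rowP/(_ (Ordinal H_gt0))/eqP; apply/negP; rewrite gt_eqF//.
  rewrite !mxE mulr1 (lt_le_trans (_ : _ < 0)) ?ltrN10//.
    by rewrite oppr_lt0.
  by apply: sumr_ge0 => j _; rewrite !mxE mul1r.
pose c := 1 + w (-2).
have c_gt0 : 0 < c by rewrite ltr_pwDl// inner_ge0.
have omegaE x : omega H x = secular t w c x.
  rewrite /omega /secular; congr (_ + _); apply: fsbig_fwiden => //.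
    by move=> a /tE.
  by move=> a [/tE].
have domP x : (forall a, a \in t -> 0 < a + 2 + x) -> omega_dom H x.
  move=> tx [a /tE/tx ax /eqP]; rewrite -subr_eq0 => /eqP xE.
  have axE : a + 2 + x = - (- a - 2 - x) by ring.
  by move: ax; rewrite axE xE oppr0 ltxx.
have [l l_lt0 [l0 tl]] := secular_zero t_gt w_gt0 c_gt0 t_neq0.
have tx x a : l <= x -> a \in t -> 0 < a + 2 + x.
  by move=> lx /tl al; rewrite (lt_le_trans al)// lerD2l.
have om_gt0 x : l < x -> 0 < secular t w c x.
  by move=> lx; rewrite -l0; apply: secular_lt.
have lambdaE : lambda_star R H = l.
  apply: set_max_eq => [|x [_]]; first by split; [exact: domP|rewrite omegaE].
  by rewrite omegaE leNgt => x0; apply/negP => /om_gt0; rewrite x0 ltxx.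
have psiE x : l < x -> psi H x = x / secular t w c x.
  move=> lx; rewrite /psi asboolT ?omegaE//; apply: domP => a at_.
  exact: tx (ltW lx) at_.
have [x x_ge0 xq] := secular_solve t_gt w_gt0 c_gt0 q_ge0.
(* Since [q] is a value of [psi] beyond [lambda_star], the partial inverse takes a genuine preimage
   at [q], not its default value. *)
have qim : (psi H @` [set x | lambda_star R H < x]) q.
  exists x => /=; first by rewrite lambdaE (lt_le_trans l_lt0).
  rewrite psiE ?(lt_le_trans l_lt0)// {1}xq mulfK// gt_eqF// om_gt0//.
  exact: lt_le_trans x_ge0.
have psi_mu : psi H mu = q by rewrite /mu /psi_star_inv pinvK// inE.
have l_mu : l < mu.
  rewrite -lambdaE.
  pose S := [set x | lambda_star R H < x].
  by apply: (surjpinv_image_sub (fun _ (h : (psi H @` S) _) => h)); exists q.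
have om_mu := om_gt0 _ l_mu.
have muE : mu = q * secular t w c mu.
  by rewrite -psi_mu psiE// divfK// gt_eqF.
have mu_ge0 : 0 <= mu by rewrite muE mulr_ge0// ltW.
have amu a : a \in s -> a + 2 + mu != 0.
  move=> as_; apply: contra_not_neq mu_nev => amu0.
  apply/evE; rewrite (_ : -2 - mu = a) //.
  by apply/eqP; rewrite -subr_eq0 -oppr_eq0 -amu0; apply/eqP; ring.
(* The matrix [A + 2 + mu] is inverted on each eigenspace separately; [amu] makes the denominators
   nonzero. *)
exists (\sum_(a <- s) (a + 2 + mu)^-1 *: proj_ones H a), (secular t w c mu).
split=> //.
  rewrite mulmx_suml scaler_sumr -big_split/= onesE big_seq [RHS]big_seq.
  apply: eq_bigr => a as_; rewrite -scalemxAl pA !scalerA -scalerDl.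
  rewrite (_ : _ + _ = 1) ?scale1r//; field; exact: amu.
rewrite inner_sumr mulr_sumr /secular /c -addrA; congr (_ + _).
have -> : \sum_(a <- t) mu / (a + 2 + mu) * w a =
    \sum_(a <- s | a != -2) mu / (a + 2 + mu) * w a.
  rewrite big_filter [RHS](bigID (fun a => w a != 0))/=.
  rewrite [X in _ = _ + X]big1 ?addr0//.
  by move=> a /andP[_ /negPn/eqP->]; rewrite mulr0.
under [RHS]eq_bigr do rewrite innerZr pw mulrA.
(* An eigenvalue -2 contributes [mu / mu * w (-2)], the second summand of [c]; otherwise [w (-2)] is
   0. *)
have [s2|s2] := boolP (-2 \in s).
  rewrite [RHS](bigD1_seq (-2))//=; congr (_ + _).
  have := amu _ s2; rewrite addNr add0r => mu_neq0.
  by rewrite divff ?mul1r.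
rewrite /w p0// inner_mulmxE mul0mx mxE add0r big_seq_cond [RHS]big_seq.
apply: eq_bigl => a; have [as_|//] := boolP (a \in s).
by apply: contraNneq s2 => <-.
Qed.

End AdjacencySpectrum.

(** * The quadratic form of the corona *)

Section VertexVectors.
Variables (R : realType) (G : sgraph).
Implicit Types (phi psi : G -> R).

Definition vec phi : 'rV[R]_#|G| := \row_i phi (enum_val i).

Lemma vecE (f : 'rV[R]_#|G|) : f = vec (fun x => f 0 (enum_rank x)).
Proof. by apply/rowP => i; rewrite mxE enum_valK. Qed.

Lemma sum_enum_val phi : \sum_(i < #|G|) phi (enum_val i) = \sum_x phi x.
Proof. by rewrite -[LHS](big_enum_val (A := G) phi); apply: eq_bigl. Qed.

Lemma inner_vec phi psi : inner (vec phi) (vec psi) = \sum_x phi x * psi x.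
Proof. by rewrite -sum_enum_val; apply: eq_bigr => i _; rewrite !mxE. Qed.

Lemma inner_ones_vec phi : inner (ones R #|G|) (vec phi) = \sum_x phi x.
Proof.
by rewrite -sum_enum_val; apply: eq_bigr => i _; rewrite !mxE mul1r.
Qed.

Lemma inner_vec_mulmx phi (m : G -> G -> R) :
  inner (vec phi) (vec phi *m \matrix_(i, j) m (enum_val i) (enum_val j)) =
  \sum_x \sum_y phi x * phi y * m y x.
Proof.
rewrite -sum_enum_val; apply: eq_bigr => i _.
rewrite !mxE -sum_enum_val mulr_sumr.
by apply: eq_bigr => j _; rewrite !mxE mulrA.
Qed.

Lemma inner_vec_dist phi : inner (vec phi) (vec phi *m dist_mx R G) =
  \sum_x \sum_y phi x * phi y * (gdist y x)%:R.
Proof. exact: inner_vec_mulmx. Qed.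

Lemma inner_vec_adj phi : inner (vec phi) (vec phi *m adj_mx R G) =
  \sum_x \sum_y phi x * phi y * (edge y x)%:R.
Proof. exact: inner_vec_mulmx. Qed.

(** Both sides are quadratic, so the optimal [f] may be given unnormalized and is rescaled here. *)
Lemma QEC_eq (m : R) (f : 'rV[R]_#|G|) :
    f != 0 -> inner (ones R #|G|) f = 0 ->
    inner f (f *m dist_mx R G) = m * inner f f ->
    (forall g, inner (ones R #|G|) g = 0 ->
      inner g (g *m dist_mx R G) <= m * inner g g) ->
  QEC R G = m.
Proof.
move=> f_neq0 f0 fm gm; apply: set_max_eq => [|_ [g [g1 g0] <-]]; last first.
  by rewrite (le_trans (gm _ g0))// g1 mulr1.
have ff : 0 < inner f f.
  by rewrite lt_def inner_ge0 andbT; apply: contra_neq f_neq0; exact: inner_eq0.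
pose c := (Num.sqrt (inner f f))^-1.
have c1 : c * (c * inner f f) = 1.
  by rewrite mulrA -expr2 exprVn sqr_sqrtr ?inner_ge0// mulVf// gt_eqF.
exists (c *: f).
  by rewrite /= innerZl !innerZr f0 mulr0 c1.
by rewrite -scalemxAl innerZl innerZr fm !(mulrCA _ m) c1 mulr1.
Qed.

(** The orthogonal complement of the all-one vector is nonzero as soon as there are two vertices,
    and [rayleigh] applies to it. *)
Lemma QEC_attained : (1 < #|G|)%N -> exists f, [/\ inner (ones R #|G|) f = 0,
  inner f f = 1, inner f (f *m dist_mx R G) = QEC R G &
  forall g, inner (ones R #|G|) g = 0 ->
    inner g (g *m dist_mx R G) <= QEC R G * inner g g].
Proof.
move=> G_gt1; pose W := kermx (ones R #|G|)^T.
have W_neq0 : W != 0.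
  rewrite -mxrank_eq0 mxrank_ker -lt0n subn_gt0 mxrank_tr.
  exact: leq_ltn_trans (rank_leq_row _) G_gt1.
have WP g : (g <= W)%MS <-> inner (ones R #|G|) g = 0.
  split=> [/sub_orthP/(_ _ (submx_refl _))|g0]; first by rewrite innerC.
  by apply/sub_orthP => _ /sub_rVP[a ->]; rewrite innerZr innerC g0 mulr0.
have [f [/WP f0 f1 fmax]] := rayleigh (dist_mx R G) W_neq0.
have QE : QEC R G = inner f (f *m dist_mx R G).
  apply: (@QEC_eq _ f) => // [||g /WP/fmax//].
    apply: contra_eq_neq f1 => ->.
    by rewrite inner_mulmxE mul0mx mxE eq_sym oner_eq0.
  by rewrite f1 mulr1.
by exists f; split=> // g /WP; rewrite QE; exact: fmax.
Qed.

End VertexVectors.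

Section CoronaForm.
Variables (R : realType) (G H : sgraph).
Hypothesis hG : gconnected G.
Variable phi : corona G H -> R.

(** These three functions are $g$, $h_x$ and $F$ for the vector [phi]. *)
Definition base_part (x : G) : R := phi (inl x).
Definition copy_part (x : G) (u : H) : R := phi (inr (x, u)).
Definition collapse (x : G) : R := base_part x + \sum_u copy_part x u.

Lemma sum_corona (psi : corona G H -> R) :
  \sum_a psi a = \sum_x (psi (inl x) + \sum_u psi (inr (x, u))).
Proof.
rewrite big_split/= pair_bigA/=.
etransitivity; first exact: (big_sumType +%R xpredT psi).
congr (_ + _).
by apply: eq_bigr => -[].
Qed.

Definition proj_base (a : corona G H) : G :=
  match a with inl x => x | inr (x, _) => x end.

Definition height (a : corona G H) : R := if a is inr _ then 1 else 0.

(** The excess over the distance of a walk forced through G: inside one copy that walk has length 2,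
    instead of 0 or 1 for equal or adjacent vertices. It is the kernel of $A_H+2$ on each copy. *)
Definition copy_form (a b : corona G H) : R :=
  match a, b with
  | inr (x, u), inr (y, v) => (x == y)%:R * (2 * (u == v)%:R + (edge v u)%:R)
  | _, _ => 0
  end.

Lemma corona_dist_decomp (a b : corona G H) : (gdist b a)%:R =
  (gdist (proj_base b) (proj_base a))%:R + height a + height b - copy_form a b.
Proof.
rewrite gdist_corona//.
case: a b => [x|[x u]] [y|[y v]] /=.
- by rewrite subr0 !addr0.
- by rewrite subr0 addr0 natr1.
- by rewrite subr0 addr0 natr1.
have [->|xy] := eqVneq y x; last by rewrite mul0r subr0 !natr1.
rewrite gdistxx; have [->|uv] := eqVneq v u.
  by rewrite edge_irrefl /=; ring.
by case: edge => /=; ring.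
Qed.

Lemma sum_proj_base (psi : G -> R) :
  \sum_a phi a * psi (proj_base a) = \sum_x collapse x * psi x.
Proof.
rewrite sum_corona; apply: eq_bigr => x _.
by rewrite mulrDl mulr_suml.
Qed.

(** After expanding the distance by [corona_dist_decomp], each [height] term has the factor $\sum_a
    \phi(a)=0$. *)
Lemma corona_form : \sum_a phi a = 0 ->
  inner (vec phi) (vec phi *m dist_mx R (corona G H)) =
  inner (vec collapse) (vec collapse *m dist_mx R G) -
  \sum_x (inner (vec (copy_part x)) (vec (copy_part x) *m adj_mx R H) +
          2 * inner (vec (copy_part x)) (vec (copy_part x))).
Proof.
move=> phi0; rewrite !inner_vec_dist.
transitivity (\sum_a (
    phi a * (\sum_b phi b * (gdist (proj_base b) (proj_base a))%:R) +
    phi a * height a * (\sum_b phi b) + phi a * (\sum_b phi b * height b) -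
    \sum_b phi a * phi b * copy_form a b)).
  apply: eq_bigr => a _; rewrite !mulr_sumr -!big_split/= -sumrN -big_split/=.
  by apply: eq_bigr => b _; rewrite corona_dist_decomp; ring.
rewrite sumrB !big_split/=.
rewrite -!mulr_suml phi0 mulr0 mul0r !addr0; congr (_ - _).
  rewrite (sum_proj_base (fun x => \sum_b phi b * (gdist (proj_base b) x)%:R)).
  apply: eq_bigr => x _.
  rewrite (sum_proj_base (fun y => (gdist y x)%:R)) mulr_sumr.
  by apply: eq_bigr => y _; rewrite mulrA.
rewrite -[RHS]big_split sum_corona; apply: eq_bigr => x _ /=.
rewrite big1 => [|b _]; last by case: b => [y|[y v]]; rewrite mulr0.
rewrite add0r inner_vec_adj inner_vec mulr_sumr -big_split/=.
apply: eq_bigr => u _; rewrite sum_corona (bigD1 x)//= mulr0 add0r.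
rewrite [X in _ + X]big1 ?addr0 => [|y yx]; last first.
  rewrite mulr0 add0r big1// => v _; rewrite eq_sym (negPf yx) mul0r mulr0//.
rewrite eqxx; under eq_bigr do rewrite mul1r mulrDr.
rewrite big_split/= addrC; congr (_ + _).
rewrite (bigD1 u)//= eqxx big1 => [|v vu].
  by rewrite addr0 /copy_part /=; ring.
by rewrite eq_sym (negPf vu) !mulr0.
Qed.

Lemma corona_norm : inner (vec phi) (vec phi) =
  \sum_x (base_part x ^+ 2 + inner (vec (copy_part x)) (vec (copy_part x))).
Proof.
rewrite inner_vec sum_corona; apply: eq_bigr => x _.
by rewrite inner_vec -expr2.
Qed.

End CoronaForm.

(** * The upper bound and the extremal vector *)

Theorem theorem4p9 (R : realType) (G H : sgraph)
  (hG : gconnected G) (hG2 : (2 <= #|G|)%N) (hH1 : (1 <= #|H|)%N)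
  (hi : ~ ev R H (-2 - psi_star_inv H (QEC R G)))
  (hii : -2 <= set_min (ev R H))
  (hiii : 0 <= QEC R G) :
  QEC R (corona G H) = psi_star_inv H (QEC R G).
Proof.
have [z [om [zE omE om_gt0 mu_ge0 muE]]] := psi_star_invP hH1 hii hiii hi.
move: (psi_star_inv H _) => mu in zE omE mu_ge0 muE hi *.
have [F0 [F0sum F0norm F0q Fle]] := QEC_attained R hG2.
set q := QEC R G in muE F0q Fle hi *; set A := adj_mx R H in zE *.
set c := inner (ones R #|H|) z in omE.
pose r := om^-1.
have om_neq0 : om != 0 by rewrite gt_eqF.
have qE : q = mu * r by rewrite muE mulfK.
have rE : r * r * (1 + mu * c) = r by rewrite -omE -mulrA mulVf ?mulr1.
have zB h : inner h (z *m A) + (2 + mu) * inner h z = inner (ones R #|H|) h.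
  by rewrite -innerZr -innerDr zE innerC.
have psd h : 0 <= inner h (h *m A) + (2 + mu) * inner h h.
  have hA := le_trans (ler_wpM2r (inner_ge0 h) hii) (set_min_ev hH1 h).
  have := mulr_ge0 mu_ge0 (inner_ge0 h); rewrite -/A in hA; lra.
have upper g h (F := g + inner (ones R #|H|) h) :
    q * F ^+ 2 <= mu * g ^+ 2 + (inner h (h *m A) + (2 + mu) * inner h h).
  set s := inner _ h in F *.
  have := psd (h + (- (q * F)) *: z).
  have -> : inner (h + (- (q * F)) *: z) ((h + (- (q * F)) *: z) *m A) +
      (2 + mu) * inner (h + (- (q * F)) *: z) (h + (- (q * F)) *: z) =
      inner h (h *m A) + (2 + mu) * inner h h - 2 * (q * F) * s +
      (q * F) ^+ 2 * c.
    rewrite mulmxDl -scalemxAl !(innerDl, innerDr, innerZl, innerZr).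
    rewrite -(inner_sym z h (adj_mx_sym R H)) -/A (innerC _ h) (innerC z h).
    by rewrite /s /c -!zB; ring.
  (* Adding this square to [psd] cancels the products of [g] and [F]; [rE], scaled by [mu * F ^+ 2],
     then reduces the terms in [F ^+ 2] to [q * F ^+ 2]. *)
  have := mulr_ge0 mu_ge0 (sqr_ge0 (g - r * F)).
  have := congr1 (fun e => mu * F ^+ 2 * e) rE.
  rewrite qE /F; lra.
pose phi0 x := F0 0 (enum_rank x); pose zeta u := z 0 (enum_rank u).
have F0E : F0 = vec phi0 by exact: vecE.
have zetaE : z = vec zeta by exact: vecE.
(* For these values both nonnegative quantities discarded in [upper] vanish. *)
pose phi (a : corona G H) : R := match a with
  | inl x => r * phi0 x
  | inr (x, u) => q * phi0 x * zeta u end.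
have copyE x : vec (copy_part phi x) = (q * phi0 x) *: z.
  by rewrite zetaE; apply/rowP => i; rewrite !mxE.
(* This holds because [r + q * c = r * om = 1]. *)
have collapseE : collapse phi = phi0.
  apply/funext => x.
  rewrite /collapse -inner_ones_vec copyE innerZr -/c /base_part /= qE.
  rewrite -[RHS]mul1r -(mulVf om_neq0) -/r omE; ring.
have phi_norm : inner (vec phi) (vec phi) = r ^+ 2 + q ^+ 2 * inner z z.
  rewrite corona_norm -[RHS]mulr1 -F0norm F0E inner_vec mulr_sumr.
  apply: eq_bigr => x _; rewrite copyE innerZl innerZr /base_part /=; ring.
have phi_sum : \sum_a phi a = 0.
  by rewrite sum_corona -[RHS]F0sum F0E inner_ones_vec -collapseE.
apply: (@QEC_eq _ _ _ (vec phi)).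
- apply: contra_eq_neq phi_norm => ->; rewrite inner_mulmxE mul0mx mxE.
  rewrite eq_sym gt_eqF// ltr_pwDl ?exprn_gt0 ?invr_gt0//.
  by rewrite mulr_ge0 ?sqr_ge0 ?inner_ge0.
- by rewrite inner_ones_vec.
- rewrite corona_form//.
  rewrite collapseE -F0E F0q phi_norm.
  (* By [zB] at [z], the form of [A + 2] at [z] is [c - mu * inner z z]. *)
  have -> : \sum_x (
      inner (vec (copy_part phi x)) (vec (copy_part phi x) *m adj_mx R H) +
      2 * inner (vec (copy_part phi x)) (vec (copy_part phi x))) =
      q ^+ 2 * (c - mu * inner z z).
    rewrite -[RHS]mulr1 -[X in _ = _ * X]F0norm F0E inner_vec mulr_sumr.
    apply: eq_bigr => x _; rewrite copyE -scalemxAl !(innerZl, innerZr).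
    by rewrite -/A /c -zB; ring.
  have := congr1 (fun e => mu * e) rE; rewrite qE; lra.
(* For an arbitrary vector of sum 0, the collapsed vector is bounded by [Fle], and [upper] is summed
   over the vertices of G. *)
move=> f; rewrite (vecE f); move: (fun _ => _) => psi.
rewrite inner_ones_vec => psi_sum; rewrite corona_form// corona_norm.
have collapse_sum : inner (ones R #|G|) (vec (collapse psi)) = 0.
  by rewrite inner_ones_vec -[RHS]psi_sum sum_corona.
rewrite lerBlDr (le_trans (Fle _ collapse_sum))//.
rewrite inner_vec !mulr_sumr -big_split/=; apply: ler_sum => x _.
have := upper (base_part psi x) (vec (copy_part psi x)).
rewrite inner_ones_vec -/(collapse psi x) -/A; cbv zeta; lra.
Qed.
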